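(* Let $\mathbf{k}=(k_1,\ldots,k_r)$ be any index (i.e. $r\ge 1$ and $k_1,\ldots,k_r\in\mathbb{Z}_{\ge1}$), of weight $|\mathbf{k}|=k_1+\cdots+k_r$. Then there exist numbers $C_{\mathbf{k}}(\mathbf{k}';j)$, indexed by indices $\mathbf{k}'$ (including the empty index $\emptyset$) and integers $j\ge0$ with $|\mathbf{k}'|+j\le|\mathbf{k}|$, such that each $C_{\mathbf{k}}(\mathbf{k}';j)$ is a $\mathbb{Q}$-linear combination of multiple $T$-values of weight $|\mathbf{k}|-|\mathbf{k}'|-j$ (the constant $1$ being regarded as a multiple $T$-value of weight $0$), and for all $0<z<1$, \[ {\rm A}\left(\mathbf{k};\frac{1-z}{1+z}\right)=\sum_{\mathbf{k}',\,j\ge0} C_{\mathbf{k}}(\mathbf{k}';j)\,{\rm A}\left(\{1\}_j;\frac{1-z}{1+z}\right){\rm A}(\mathbf{k}';z). \]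
   Context: For an index $(k_1,\ldots,k_r)$ and $z\in[-1,1)$, ${\rm A}(k_1,\ldots,k_r;z)=2^r\sum_{1\le n_1<\cdots<n_r,\ n_i\equiv i \pmod 2}\frac{z^{n_r}}{n_1^{k_1}\cdots n_r^{k_r}}$; ${\rm A}(\emptyset;z)=1$ and $|\emptyset|=0$. $\{1\}_j$ denotes $j$ repetitions of $1$. An index is admissible if $k_r\ge2$; for admissible indices the multiple $T$-value is $T(k_1,\ldots,k_r)=2^r\sum_{0<m_1<\cdots<m_r,\ m_i\equiv i\pmod 2}\frac{1}{m_1^{k_1}\cdots m_r^{k_r}}={\rm A}(k_1,\ldots,k_r;1)$, of weight $k_1+\cdots+k_r$. *)

(* Defs.v *)
From HB Require Import structures.
From mathcomp Require Import all_boot all_order all_algebra.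
From mathcomp Require Import boolp classical_sets functions cardinality fsbigop.
From mathcomp Require Import reals topology normedtype sequences.

Set Implicit Arguments.
Unset Strict Implicit.
Unset Printing Implicit Defensive.

Import Order.TTheory GRing.Theory Num.Theory.
Import numFieldNormedType.Exports.

Local Open Scope classical_set_scope.
Local Open Scope ring_scope.

(* An index (k_1, ..., k_r) is a sequence of positive naturals; [::] is the
   empty index. *)
Definition is_index (k : seq nat) : bool := all (fun ki => (0 < ki)%N) k.

Definition weight (k : seq nat) : nat := sumn k.

Definition admissible (k : seq nat) : bool :=
  [&& is_index k, k != [::] & (2 <= last 0 k)%N].

(* 0 < n_1 < ... < n_r and n_i = i mod 2. The i-th entry of the sequence,
   counted from 0, is n_(i+1). *)
Definition summation_range (n : seq nat) : bool :=
  path ltn 0%N n &&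
  [forall i : 'I_(size n), (nth 0 n i == i.+1 %[mod 2])%N].

(* For the empty n, last 0 n = 0 and the term is 1. *)
Definition A_term (R : realType) (k n : seq nat) (z : R) : R :=
  z ^+ last 0%N n / \prod_(i < size k) (nth 0%N n i)%:R ^+ nth 0%N k i.

(* The part n_r <= N of the multiple sum. *)
Definition A_partial (R : realType) (k : seq nat) (z : R) (N : nat) : R :=
  2 ^+ size k *
    \sum_(n : (size k).-tuple 'I_N.+1 | summation_range (map val n))
      A_term k (map val n) z.

Definition A (R : realType) (k : seq nat) (z : R) : R :=
  limn (A_partial k z).

Definition T (R : realType) (k : seq nat) : R := A k 1.

(* The constant 1 counts as a multiple T-value of weight 0. *)
Definition is_T_value (R : realType) (w : nat) (x : R) : Prop :=
  (w = 0%N /\ x = 1) \/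
  (exists k : seq nat, [/\ admissible k, weight k = w & x = T R k]).

(* The empty combination is allowed, so 0 is a combination in every weight;
   it is the only one in weight 1. *)
Definition T_combination (R : realType) (w : nat) (x : R) : Prop :=
  exists s : seq (rat * R),
    (forall p, p \in s -> is_T_value w p.2) /\
    x = \sum_(p <- s) ratr p.1 * p.2.

Definition index_pairs (w : nat) : set (seq nat * nat) :=
  [set p | is_index p.1 /\ (weight p.1 + p.2 <= w)%N].

Lemma A_nil (R : realType) (z : R) : A [::] z = 1.
Proof.
rewrite /A (_ : A_partial [::] z = fun=> 1) ?lim_cst //.
apply/funext => N; rewrite /A_partial expr0 mul1r (big_pred1 [tuple]).
  by rewrite /A_term big_ord0 /= expr0 divr1.
move=> n; transitivity true; last by apply/esym/eqP; exact: tuple0.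
by rewrite (tuple0 n); apply/andP; split=> //; apply/forallP => -[].
Qed.

(* \sum_(p \in D) is 0 by convention on infinite supports; this rules the
   convention out. *)
Lemma finite_index_pairs (w : nat) : finite_set (index_pairs w).
Proof.
pose s := [seq (map val (tval (tagged x.1)), val x.2) |
  x : {r : 'I_w.+1 & (val r).-tuple 'I_w.+1} * 'I_w.+1].
apply: (@sub_finite_set _ _ [set` s]) => // -[k j] [/= kpos kw].
have k_le i : i \in k -> (i <= sumn k)%N.
  by elim: (k) => //= a l IH; rewrite inE => /predU1P[->|/IH h];
    rewrite ?leq_addr // (leq_trans h) ?leq_addl.
have size_le : (size k <= sumn k)%N.
  by elim: (k) kpos => //= a l IH /andP[a0 /IH h]; rewrite -add1n leq_add.
have kw' : (sumn k <= w)%N by rewrite (leq_trans _ kw) ?leq_addr.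
have rw : (size k < w.+1)%N by rewrite ltnS (leq_trans size_le).
have jw : (j < w.+1)%N by rewrite ltnS (leq_trans _ kw) ?leq_addl.
pose t : (val (Ordinal rw)).-tuple 'I_w.+1 := map_tuple inord (in_tuple k).
apply/mapP; exists (Tagged (fun r : 'I_w.+1 => (val r).-tuple 'I_w.+1) t, Ordinal jw).
  by rewrite mem_enum.
congr pair; rewrite /= -map_comp -[LHS]map_id; apply/eq_in_map => i ik /=.
by rewrite inordK // ltnS (leq_trans (k_le _ ik)).
Qed.

(* Main.v *)
Require Import Defs.
From HB Require Import structures.
From mathcomp Require Import all_boot all_order all_algebra.
From mathcomp Require Import boolp classical_sets functions cardinality fsbigop.
From mathcomp Require Import reals topology normedtype sequences.
From mathcomp Require Import derive realfun exp ring lra.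

Set Implicit Arguments.
Unset Strict Implicit.
Unset Printing Implicit Defensive.

Import Order.TTheory GRing.Theory Num.Theory.
Import numFieldNormedType.Exports.

Local Open Scope classical_set_scope.
Local Open Scope ring_scope.

(** A(k; z) is an iterated integral of the forms dz/z and 2dz/(1-z^2), and the
    substitution z |-> (1-z)/(1+z) exchanges these two forms up to sign.  For
    admissible k, the derivative of A(k; (1-z)/(1+z)) is therefore -2/(1-z^2)
    times a function of smaller weight of the same kind; one inserts the
    expansion of the latter and integrates by parts, which stays within the
    products A({1}_j; (1-z)/(1+z)) A(k'; z) because A({1}_j) = A(1)^j / j!.
    The constant of integration is read off at z -> 0, where all these products
    vanish and A(k; (1-z)/(1+z)) tends to T(k) by Abel's theorem.  An index
    ending in 1 is first rewritten, again by integration by parts, as a rational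
    polynomial in A(1; .) with coefficients A(l; .), l admissible or empty. *)

(** * Power series with coefficients of subexponential growth *)

Section PowerSeries.
Variable R : realType.
Implicit Types (c : nat -> R) (x q K : R).

(** Equivalent to radius of convergence at least 1. Unlike boundedness, this survives
    [pseries_diffs], which must be applied twice to meet the conditions of [pseries_snd_diffs]. *)
Definition damped c := forall K, 0 < K < 1 -> exists M, forall n, `|c n| * K ^+ n <= M.

Lemma bounded_damped c M : (forall n, `|c n| <= M) -> damped c.
Proof.
move=> cM K /andP[K0 K1]; exists M => n.
by rewrite (le_trans _ (cM n))// ler_piMr// exprn_ile1// ltW.
Qed.

(** (1 - q^n)/(1 - q) = 1 + q + ... + q^(n-1) has n summands, each at least q^n. *)
Lemma natr_expr_bound q n : 0 < q < 1 -> n%:R * q ^+ n <= (1 - q)^-1.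
Proof.
move=> /andP[q0 q1]; have q1' : 0 < 1 - q by rewrite subr_gt0.
rewrite -[leRHS]mul1r ler_pdivlMr//.
suff : n%:R * q ^+ n * (1 - q) <= 1 - q ^+ n.
  by have := exprn_gt0 n q0; lra.
elim: n => [|n IH]; first by rewrite mul0r mul0r expr0 subrr.
have qn0 := exprn_gt0 n q0.
have qn1 : q ^+ n <= 1 by rewrite exprn_ile1 ?ltW.
have qIH := ler_wpM2l (ltW q0) IH.
have : 0 <= (1 - q) * (1 - q * q ^+ n).
  by rewrite mulr_ge0 ?(ltW q1')// subr_ge0 mulr_ile1 ?(ltW q0) ?(ltW q1) ?(ltW qn0).
rewrite exprS -natr1; lra.
Qed.

Lemma damped_diffs c : damped c -> damped (pseries_diffs c).
Proof.
move=> cd K /andP[K0 K1].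
(* The growth hypothesis is used at a point between [K] and 1; the spare ratio K/K' < 1 absorbs the
   factor n + 1 brought in by differentiation. *)
pose K' := (1 + K) / 2; have K'0 : 0 < K' by rewrite /K'; lra.
have K'1 : K' < 1 by rewrite /K'; lra.
have KK' : 0 < K / K' < 1.
  by rewrite divr_gt0//= ltr_pdivrMr// mul1r /K'; lra.
have [M HM] := cd K' (introT andP (conj K'0 K'1)).
exists (M * (1 - K / K')^-1 / K) => n.
rewrite /pseries_diffs normrM normr_nat ler_pdivlMr// -mulrA -exprSr.
have -> : K ^+ n.+1 = K' ^+ n.+1 * (K / K') ^+ n.+1.
  by rewrite -exprMn mulrCA divff ?mulr1// gt_eqF.
rewrite [leLHS](_ : _ = (`|c n.+1| * K' ^+ n.+1) * (n.+1%:R * (K / K') ^+ n.+1)).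
  apply: ler_pM => //; last exact: natr_expr_bound.
    by rewrite mulr_ge0// exprn_ge0// ltW.
  by rewrite mulr_ge0// exprn_ge0// ltW//; case/andP: KK'.
by rewrite [n.+1%:R * `|_|]mulrC mulrACA.
Qed.

Lemma damped_cvg c x : damped c -> `|x| < 1 -> cvgn (pseries c x).
Proof.
move=> cd x1; have x0 := normr_ge0 x.
have [K [K0 K1 xK]] : exists K, [/\ 0 < K, K < 1 & `|x| < K].
  by exists ((1 + `|x|) / 2); split; lra.
have [M HM] := cd K (introT andP (conj K0 K1)).
apply: normed_cvg; rewrite /pseries.
apply: (@series_le_cvg _ _ (geometric M (`|x| / K))).
- by move=> n /=.
- move=> n; rewrite /geometric/= mulr_ge0 ?exprn_ge0 ?divr_ge0 ?(ltW K0)//.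
  by have := HM 0; rewrite expr0 mulr1; exact: le_trans.
- move=> n; rewrite /geometric/= normrM normrX expr_div_n mulrA.
  by rewrite ler_pdivlMr ?exprn_gt0// mulrAC ler_wpM2r ?exprn_ge0.
- apply: is_cvg_geometric_series.
  rewrite ger0_norm ?divr_ge0 ?(ltW K0)//.
  by rewrite ltr_pdivrMr// mul1r.
Qed.

Lemma damped_is_derive c x : damped c -> `|x| < 1 ->
  is_derive x 1 (fun y => limn (pseries c y)) (limn (pseries (pseries_diffs c) x)).
Proof.
move=> cd x1; have x0 := normr_ge0 x.
pose K := (1 + `|x|) / 2; have K0 : 0 < K by rewrite /K; lra.
have K1 : `|K| < 1 by rewrite ger0_norm ?(ltW K0)// /K; lra.
apply: (@pseries_snd_diffs _ _ K).
- exact: damped_cvg.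
- by apply: damped_cvg => //; exact: damped_diffs.
- by apply: damped_cvg => //; do 2 apply: damped_diffs.
- by rewrite (ger0_norm (ltW K0)) /K; lra.
Qed.

End PowerSeries.

(** * Iterated integrals indexed by words *)

Section Words.
Variable R : realType.
Implicit Types (w v : seq bool) (x z : R).

(* The head of a word is the outermost form of the iterated integral: [true]
   stands for 2dx/(1-x^2) and [false] for dx/x.  [wcoef w] lists the Taylor
   coefficients; at [n = 0] the divisions give the right value [0]. *)
Fixpoint wcoef w (n : nat) : R :=
  match w with
  | [::] => (n == 0)%:R
  | true :: w' => 2 / n%:R * \sum_(m < n | odd m != odd n) wcoef w' m
  | false :: w' => wcoef w' n / n%:R
  end.

Definition li w x : R := limn (pseries (wcoef w) x).

Lemma wcoef_ge0 w n : 0 <= wcoef w n.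
Proof.
elim: w n => [n|[] w IH n] /=; first by rewrite ler0n.
  by rewrite mulr_ge0 ?divr_ge0 ?sumr_ge0.
by rewrite divr_ge0.
Qed.

Lemma wcoef0 w : w != [::] -> wcoef w 0 = 0.
Proof. by case: w => [//|[] w] _ /=; rewrite invr0 ?mulr0 ?mul0r. Qed.

(** The division by n compensates for the at most n summands, so a letter costs at most a factor
    2. *)
Lemma wcoef_le w n : wcoef w n <= 2 ^+ size w.
Proof.
elim: w n => [n|b w IH n].
  by rewrite /= expr0 -[1]/(1%:R) ler_nat leq_b1.
have [->|n0] := eqVneq n 0%N; first by rewrite wcoef0 ?exprn_ge0.
have n0' : 0 < n%:R :> R by rewrite ltr0n lt0n.
case: b => /=.
  rewrite exprS -mulrA ler_pM2l// mulrC ler_pdivrMr//.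
  apply: le_trans (_ : \sum_(m < n) wcoef w m <= _).
    rewrite big_mkcond /=; apply: ler_sum => m _; case: ifP => // _.
    exact: wcoef_ge0.
  apply: le_trans (_ : \sum_(m < n) 2 ^+ size w <= _).
    by apply: ler_sum => m _; exact: IH.
  by rewrite sumr_const card_ord mulr_natr.
rewrite ler_pdivrMr// (le_trans (IH n))// exprS.
have n1 : 1 <= n%:R :> R by rewrite ler1n lt0n.
have := exprn_gt0 (size w) (ltr0Sn R 1); nra.
Qed.

Lemma wcoef_damped w : damped (wcoef w).
Proof.
apply: (@bounded_damped _ _ (2 ^+ size w)) => n.
by rewrite ger0_norm ?wcoef_ge0// wcoef_le.
Qed.

Lemma li_nil x : li [::] x = 1.
Proof.
(* The partial sum with no terms is 0, so the sequence is constant only after a shift. *)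
rewrite /li; apply/cvg_lim => //; rewrite -cvg_shiftS.
rewrite (_ : (fun n => _) = fun=> 1); first exact: cvg_cst.
apply/funext => n; rewrite /pseries /series /= big_nat_recl//= expr0 mulr1.
by rewrite big1 ?addr0// => i _; rewrite mul0r.
Qed.

Lemma li0 w : w != [::] -> li w 0 = 0.
Proof.
move=> w0; rewrite /li; apply/cvg_lim => //.
rewrite (_ : pseries _ _ = fun=> 0); first exact: cvg_cst.
apply/funext => n; rewrite /pseries /series /= big1// => -[|i] _.
  by rewrite wcoef0// mul0r.
by rewrite exprS mul0r mulr0.
Qed.

Lemma li_is_derive w x : `|x| < 1 ->
  is_derive x 1 (li w) (limn (pseries (pseries_diffs (wcoef w)) x)).
Proof. by move=> x1; apply: damped_is_derive => //; exact: wcoef_damped. Qed.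

Lemma li_continuous w x : `|x| < 1 -> {for x, continuous (li w)}.
Proof.
move=> x1; apply: differentiable_continuous; apply/derivable1_diffP.
by have [] := li_is_derive w x1.
Qed.

Definition dform (b : bool) x : R := if b then 2 / (1 - x ^+ 2) else x^-1.

(* The coefficients [d] of the derivative satisfy [d n.+2 = d n + 2 wcoef w n.+2]. *)
Lemma li_is_derive_true w x : `|x| < 1 ->
  is_derive x 1 (li (true :: w)) (dform true x * li w x).
Proof.
move=> x1; rewrite [X in is_derive _ _ _ X](_ : _ =
  limn (pseries (pseries_diffs (wcoef (true :: w))) x)); first exact: li_is_derive.
pose d := pseries_diffs (wcoef (true :: w)).
have dE n : d n = 2 * \sum_(m < n.+1 | odd m == odd n) wcoef w m.
  rewrite /d /pseries_diffs /= [_ / _]mulrC -mulrA mulVKf ?pnatr_eq0//.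
  by congr (_ * _); apply: eq_bigl => i /=; case: (odd i); case: (odd n).
have dS n : d n.+2 = d n + 2 * wcoef w n.+2.
  rewrite !dE -mulrDr; congr (_ * _); rewrite big_mkcond 2!big_ord_recr/= -big_mkcond.
  by rewrite negbK eqxx; case: (odd n); rewrite /= addr0.
have cd : cvgn (pseries d x).
  by apply: damped_cvg => //; apply: damped_diffs; exact: wcoef_damped.
have cw : cvgn (pseries (wcoef w) x) by apply: damped_cvg => //; exact: wcoef_damped.
(* The recurrence for [d], summed: multiplication by 1 - x^2 telescopes to twice the series of [w].
   Multiplication by x^2 shifts the truncation by two. *)
have partialE n : pseries d x n.+2 - x ^+ 2 * pseries d x n = 2 * pseries (wcoef w) x n.+2.
  rewrite /pseries /series /=; elim: n => [|n IH].
    rewrite !big_nat_recr//= !big_geq// !dE big_mkcond /= !big_ord_recr /= !big_ord0 /=.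
    rewrite big_mkcond /= !big_ord_recr /= !big_ord0 /=; ring.
  rewrite big_nat_recr//= [in RHS]big_nat_recr//= mulrDr -IH dS.
  rewrite [in X in _ - X = _]big_nat_recr//= !exprS; ring.
have x2 : 1 - x ^+ 2 != 0.
  rewrite subr_eq0 eq_sym; apply/negP => /eqP h.
  have : `|x| ^+ 2 = 1 by rewrite real_normK ?num_real.
  have := normr_ge0 x; nra.
have : (1 - x ^+ 2) * limn (pseries d x) = 2 * li w x.
  rewrite mulrBl mul1r.
  have cd2 : (fun n => pseries d x n.+2) @ \oo --> limn (pseries d x).
    by rewrite (cvg_shiftS (fun n => pseries d x n.+1)) cvg_shiftS.
  have cw2 : (fun n => pseries (wcoef w) x n.+2) @ \oo --> li w x.
    by rewrite (cvg_shiftS (fun n => pseries (wcoef w) x n.+1)) cvg_shiftS.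
  have : (fun n => pseries d x n.+2 - x ^+ 2 * pseries d x n) @ \oo -->
      limn (pseries d x) - x ^+ 2 * limn (pseries d x).
    by apply: cvgB => //; apply: cvgMl_tmp.
  rewrite (_ : (fun n => _) = (fun n => 2 * pseries (wcoef w) x n.+2)); last first.
    by apply/funext.
  move=> h; apply: (cvg_unique _ h) => //.
  by apply: cvgMl_tmp.
by rewrite /dform mulrAC => <-; rewrite mulrAC divff// mul1r.
Qed.

Lemma li_is_derive_false w x : w != [::] -> `|x| < 1 -> x != 0 ->
  is_derive x 1 (li (false :: w)) (dform false x * li w x).
Proof.
move=> w0 x1 x0; rewrite [X in is_derive _ _ _ X](_ : _ =
  limn (pseries (pseries_diffs (wcoef (false :: w))) x)); first exact: li_is_derive.
pose d := pseries_diffs (wcoef (false :: w)).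
have cd : cvgn (pseries d x).
  by apply: damped_cvg => //; apply: damped_diffs; exact: wcoef_damped.
have cw : cvgn (pseries (wcoef w) x) by apply: damped_cvg => //; exact: wcoef_damped.
(* Since [w] is nonempty its constant coefficient vanishes, and a factor [x] splits off the
   remaining series. *)
suff h : x * limn (pseries d x) = li w x by rewrite /dform -h mulKf.
have cw1 : (fun n => pseries (wcoef w) x n.+1) @ \oo --> li w x by rewrite cvg_shiftS.
apply: (cvg_unique _ _ cw1) => //.
rewrite (_ : (fun n => _) = (fun n => x * pseries d x n)); first exact: cvgMl_tmp.
apply/funext => n; rewrite /pseries /series /= big_nat_recl//= wcoef0// mul0r add0r.
rewrite mulr_sumr; apply: eq_bigr => i _.
rewrite /d /pseries_diffs /= exprS mulrCA; congr (_ * (_ * _)).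
by rewrite mulrC divfK// pnatr_eq0.
Qed.

End Words.

Arguments dform : simpl never.

(** * Words and indices *)

Section Indices.
Variable R : realType.

(* The argument lists the exponents from the outermost to the innermost, that
   is, [s] is the reversal of the index. *)
Fixpoint icoef (s : seq nat) (n : nat) : R :=
  if s is c :: s' then 2 / n%:R ^+ c * \sum_(m < n | odd m != odd n) icoef s' m
  else (n == 0)%:R.

Lemma big_tuple_rcons (r M : nat) (F : seq nat -> R) :
  \sum_(t : r.+1.-tuple 'I_M) F (map val t) =
  \sum_(t : r.-tuple 'I_M) \sum_(n < M) F (rcons (map val t) n).
Proof.
rewrite pair_big /=.
pose h (p : r.-tuple 'I_M * 'I_M) : r.+1.-tuple 'I_M := [tuple of rcons p.1 p.2].
rewrite (reindex h) /=.
  by apply: eq_bigr => -[t n] _ /=; rewrite map_rcons.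
apply: onW_bij; apply: inj_card_bij; last first.
  by rewrite card_prod !card_tuple card_ord expnSr.
move=> [t n] [t' n'] /(congr1 val) /= /rcons_inj [tt' ->].
by congr pair; apply: val_inj.
Qed.

Lemma summation_range_rcons (t : seq nat) (n : nat) :
  summation_range (rcons t n) =
  [&& summation_range t, (last 0 t < n)%N & (n == (size t).+1 %[mod 2])%N].
Proof.
rewrite /summation_range rcons_path -!andbA; congr (_ && _).
rewrite andbCA; congr (_ && _); apply/forallP/andP.
  move=> h; split.
    apply/forallP => i; have ir : (i < size (rcons t n))%N by rewrite size_rcons ltnS ltnW.
    by have := h (Ordinal ir); rewrite /= nth_rcons ltn_ord.
  have tr : (size t < size (rcons t n))%N by rewrite size_rcons.
  by have := h (Ordinal tr); rewrite /= nth_rcons ltnn eqxx.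
move=> [/forallP h hn] [i /= ir]; rewrite nth_rcons.
move: ir; rewrite size_rcons ltnS leq_eqVlt => /orP[/eqP ->|ir].
  by rewrite ltnn eqxx.
by rewrite ir; exact: (h (Ordinal ir)).
Qed.

(** Turns the condition n_i = i mod 2 into the relative one in [icoef], that neighbouring variables
    have different parity; the default 0 plays the part of n_0. *)
Lemma odd_last_range (t : seq nat) : summation_range t -> odd (last 0%N t) = odd (size t).
Proof.
case/lastP: t => // t n; rewrite summation_range_rcons last_rcons size_rcons.
by case/and3P => _ _; rewrite !modn2 /=; case: (odd n); case: (odd (size t)).
Qed.

(* A general weight [g] on the outermost variable makes the induction go
   through: the outermost sum is absorbed into [g]. *)
Lemma sum_tuple_icoef (s : seq nat) (N : nat) (g : nat -> R) :
  2 ^+ size s * (\sum_(t : (size s).-tuple 'I_N.+1 | summation_range (map val t))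
    g (last 0%N (map val t)) /
      \prod_(i < size s) (nth 0%N (map val t) i)%:R ^+ nth 0%N (rev s) i) =
  \sum_(m < N.+1) icoef s m * g m.
Proof.
elim: s g => [|c s IH] g.
  rewrite expr0 mul1r (big_pred1 [tuple]) => [|t]; last first.
    transitivity true; last by apply/esym/eqP; exact: tuple0.
    by rewrite (tuple0 t); apply/andP; split=> //; apply/forallP => -[].
  rewrite big_ord0 /= divr1 big_ord_recl /= mul1r big1 ?addr0// => i _.
  by rewrite mul0r.
pose g' m : R := \sum_(n < N.+1 | (m < n)%N && (odd m != odd n)) 2 / n%:R ^+ c * g n.
transitivity (\sum_(m < N.+1) icoef s m * g' m).
  rewrite -IH exprS /= big_mkcond /= (big_tuple_rcons _ _ (fun l =>
    if summation_range l then g (last 0%N l) /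
      \prod_(i < (size s).+1) (nth 0%N l i)%:R ^+ nth 0%N (rev (c :: s)) i else 0)).
  rewrite [2 * _]mulrC -mulrA; congr (_ * _); rewrite mulr_sumr [RHS]big_mkcond /=.
  apply: eq_bigr => t _.
  have st : size (map val t) = size s by rewrite size_map size_tuple.
  case: ifP => rt; last first.
    rewrite big1 ?mulr0// => n _; by rewrite summation_range_rcons rt.
  rewrite /g' mulr_sumr mulr_suml [RHS]big_mkcond /=; apply: eq_bigr => n _.
  rewrite summation_range_rcons rt /= st.
  have -> : (n == (size s).+1 %[mod 2])%N = (odd (last 0%N (map val t)) != odd n).
    by rewrite odd_last_range// st !modn2 /=; case: (odd n); case: (odd (size s)).
  case: ifP => _; last by rewrite mulr0.
  rewrite last_rcons big_ord_recr /= rev_cons !nth_rcons st size_rev ltnn eqxx.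
  rewrite (eq_bigr (fun i : 'I_(size s) =>
    (nth 0%N (map val t) i)%:R ^+ nth 0%N (rev s) i)); last first.
    by move=> i _; rewrite !nth_rcons st size_rev ltn_ord.
  rewrite invfM; ring.
rewrite /g'; under eq_bigr do rewrite mulr_sumr big_mkcond.
rewrite exchange_big /=; apply: eq_bigr => n _.
rewrite -big_mkcond (big_ord_widen_cond N.+1 (fun m => odd m != odd n) (icoef s)) 1?ltnW//.
by rewrite [RHS]mulrAC mulr_sumr; apply: eq_big => [i|i _]; rewrite 1?andbC// mulrC.
Qed.

Lemma A_partialE (k : seq nat) (z : R) (N : nat) :
  A_partial k z N = pseries (icoef (rev k)) z N.+1.
Proof.
rewrite -[k in LHS]revK; move: (rev k) => s.
rewrite /A_partial /A_term size_rev /pseries /series /= big_mkord.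
by rewrite (sum_tuple_icoef s N (fun m => z ^+ m)).
Qed.

(** The reversed index, outermost exponent first: [true] contributes an exponent 1, and each [false]
    in front of it raises that exponent. The default [[::]] in the last branch is met only on words
    that are not [good]. *)
Fixpoint idx (w : seq bool) : seq nat :=
  match w with
  | [::] => [::]
  | true :: w' => 1%N :: idx w'
  | false :: w' => if idx w' is c :: s then c.+1 :: s else [::]
  end.

Fixpoint word (s : seq nat) : seq bool :=
  if s is c :: s' then nseq c.-1 false ++ true :: word s' else [::].

(* The innermost form is not dx/x. *)
Definition good (w : seq bool) := last true w.

Lemma goodW b w : good (b :: w) -> good w.
Proof. by case: w. Qed.

Lemma good_cons b w : w != [::] -> good (b :: w) = good w.
Proof. by case: w. Qed.

Lemma good_word s : good (word s).
Proof.
elim: s => //= c s IH; rewrite /good last_cat /=.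
by case: (word s) IH.
Qed.

Lemma idx_nil w : good w -> idx w = [::] -> w = [::].
Proof.
elim: w => // b w IH gw; case: b gw => //= gw; case E : (idx w) => // _.
by move: (gw); rewrite (IH (goodW gw) E).
Qed.

Lemma idx_word s : is_index s -> idx (word s) = s.
Proof.
elim: s => //= -[|c] s IH //= /IH; elim: c => //= [-> //|c IHc h].
by rewrite IHc.
Qed.

Lemma is_index_idx w : is_index (idx w).
Proof. by elim: w => //= -[] w //=; case: (idx w) => [|c s] //= /andP[_ ->]. Qed.

Lemma weight_idx w : good w -> weight (idx w) = size w.
Proof.
elim: w => //= b w IH gw; have := IH (goodW gw); case: b gw => gw.
  by rewrite /weight /= add1n => ->.
case E : (idx w) => [|c s]; last by rewrite /weight /= addSn => ->.
by move: (gw); rewrite (idx_nil (goodW gw) E).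
Qed.

Lemma wcoef_idx w : good w -> wcoef R w = icoef (idx w).
Proof.
elim: w => //= b w IH gw; apply/funext => n; case: b gw => gw /=.
  by rewrite expr1 IH// (goodW gw).
rewrite (IH (goodW gw)); case E : (idx w) => [|c s] /=.
  by move: (gw); rewrite (idx_nil (goodW gw) E).
rewrite exprS invfM; ring.
Qed.

Lemma A_idx w z : good w -> A (rev (idx w)) z = li w z :> R.
Proof.
move=> gw; rewrite /A /li wcoef_idx//.
rewrite (_ : A_partial _ _ = fun n => pseries (icoef (idx w)) z n.+1).
   pose p := pseries (icoef (idx w)) z.
  have h1 : (fun n => p n.+1) @ \oo `=>` p @ \oo by rewrite cvg_shiftS.
  have h2 : p @ \oo `=>` (fun n => p n.+1) @ \oo by rewrite -cvg_shiftS.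
  by congr (lim _); apply/seteqP; split.
by apply/funext => N; rewrite A_partialE revK.
Qed.

End Indices.

(** * Values at 1 *)

Section Abel.
Variable R : realType.

(** Telescoping: if a^2 = b^2 + 1, then 1/a <= 2(a - b) amounts to (a - b)^2 >= 0. *)
Lemma sum_inv_sqrt (n : nat) : \sum_(m < n) (Num.sqrt m.+1%:R)^-1 <= 2 * Num.sqrt n%:R :> R.
Proof.
elim: n => [|n IH]; first by rewrite big_ord0 mulr_ge0 ?sqrtr_ge0.
rewrite big_ord_recr /= (le_trans (lerD IH (lexx _)))//.
have b0 := sqrtr_ge0 (n%:R : R).
have a0 : 0 < Num.sqrt n.+1%:R :> R by rewrite sqrtr_gt0 ltr0n.
have : Num.sqrt n.+1%:R ^+ 2 = Num.sqrt n%:R ^+ 2 + 1 :> R by rewrite !sqr_sqrtr// natr1.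
move: (Num.sqrt n.+1%:R) (Num.sqrt n%:R) a0 b0 => a b a0 b0 ab.
rewrite addrC -lerBrDr -[_^-1]mul1r ler_pdivrMr//.
have := sqr_ge0 (a - b); lra.
Qed.

(** Telescoping again, through 1/a^3 <= 2/b - 2/a for a^2 = b^2 + 1; the subtracted term is what
    lets the induction close, with equality at n = 0. *)
Lemma sum_inv_sqrt3 (n : nat) :
  \sum_(m < n.+1) (Num.sqrt m.+1%:R ^+ 3)^-1 <= 3 - 2 / Num.sqrt n.+1%:R :> R.
Proof.
elim: n => [|n IH]; first by rewrite big_ord_recr big_ord0 /= sqrtr1 expr1n !invr1; lra.
rewrite big_ord_recr /= (le_trans (lerD IH (lexx _)))//.
have b0 : 0 < Num.sqrt n.+1%:R :> R by rewrite sqrtr_gt0 ltr0n.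
have a0 : 0 < Num.sqrt n.+2%:R :> R by rewrite sqrtr_gt0 ltr0n.
have : Num.sqrt n.+2%:R ^+ 2 = Num.sqrt n.+1%:R ^+ 2 + 1 :> R by rewrite !sqr_sqrtr// natr1.
move: (Num.sqrt n.+2%:R) (Num.sqrt n.+1%:R) a0 b0 => a b a0 b0 ab.
have ba : b <= a by nra.
suff : (a ^+ 3)^-1 <= 2 / b - 2 / a by lra.
rewrite -[leLHS]mul1r ler_pdivrMr ?exprn_gt0//.
rewrite (_ : (2 / b - 2 / a) * a ^+ 3 = (2 * a ^+ 2 * (a - b)) / b); last first.
  by field; rewrite !gt_eqF.
rewrite ler_pdivlMr// mul1r.
have : (a - b) * (a + b) = 1 by lra.
have ab0 : 0 < a + b by lra.
move=> h; rewrite -(ler_pM2r ab0) -[leRHS]mulrA h mulr1; nra.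
Qed.

(** The coefficients are in fact O((log n)^r / n). The weaker order n^(-1/2) is preserved by both
    letters, and one further [false] makes it the summable n^(-3/2). *)
Lemma wcoef_sqrt w : exists2 C : R, 0 <= C & forall n, wcoef R w n.+1 * Num.sqrt n.+1%:R <= C.
Proof.
elim: w => [|[] w [C C0 HC]].
- by exists 0 => // n; rewrite /= mul0r.
(* The first summand comes from the term m = 0, which the induction hypothesis does not cover, the
   second from [sum_inv_sqrt]. *)
- exists (2 * 2 ^+ size w + 4 * C); first by rewrite addr_ge0 ?mulr_ge0 ?exprn_ge0.
  move=> n /=.
  have sn : 0 < Num.sqrt n.+1%:R :> R by rewrite sqrtr_gt0 ltr0n.
  have sn1 : 1 <= Num.sqrt n.+1%:R :> R by rewrite -[leLHS]sqrtr1 ler_sqrt ?ler1n.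
  have snn : Num.sqrt n%:R <= Num.sqrt n.+1%:R :> R by rewrite ler_sqrt ?ler_nat.
  have nE : n.+1%:R = Num.sqrt n.+1%:R ^+ 2 :> R by rewrite sqr_sqrtr.
  have S : \sum_(m < n.+1 | odd m != ~~ odd n) wcoef R w m <= 2 ^+ size w + C * (2 * Num.sqrt n%:R).
    apply: le_trans (_ : \sum_(m < n.+1) wcoef R w m <= _).
      rewrite big_mkcond /=; apply: ler_sum => m _; case: ifP => // _.
      exact: wcoef_ge0.
    rewrite big_ord_recl lerD ?wcoef_le//.
    apply: le_trans (ler_wpM2l C0 (sum_inv_sqrt n)).
    rewrite mulr_sumr; apply: ler_sum => i _.
    by rewrite ler_pdivlMr ?HC// sqrtr_gt0 ltr0n.
  have p0 : 0 <= 2 ^+ size w :> R by rewrite exprn_ge0.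
  move: S snn sn sn1 p0 nE (sqrtr_ge0 (n%:R : R)).
  move: (\sum_(_ < _ | _) _) (Num.sqrt n%:R) (Num.sqrt n.+1%:R) (2 ^+ _) =>
    S b a p hS hba ha ha1 hp -> hb.
  rewrite (_ : 2 / a ^+ 2 * S * a = 2 * S / a); last by field; rewrite gt_eqF.
  rewrite ler_pdivrMr//; nra.
- exists C => // n /=.
  rewrite mulrAC ler_pdivrMr ?ltr0n// (le_trans (HC n))// ler_peMr// ler1n//.
Qed.

Lemma pseries_nondecreasing (c : nat -> R) x : (forall n, 0 <= c n) -> 0 <= x ->
  {homo pseries c x : n m / (n <= m)%N >-> n <= m}.
Proof.
move=> c0 x0; apply/nondecreasing_seqP => n.
by rewrite /pseries /series /= big_nat_recr//= lerDl mulr_ge0 ?exprn_ge0.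
Qed.

Lemma wcoef_cvg1 w : w != [::] -> cvgn (pseries (wcoef R (false :: w)) 1).
Proof.
move=> w0; apply: nondecreasing_is_cvgn.
  by apply: pseries_nondecreasing => // n; exact: wcoef_ge0.
have [C C0 HC] := wcoef_sqrt w.
exists (C * 3) => _ [n _ <-].
apply: le_trans (_ : pseries (wcoef R (false :: w)) 1 n.+2 <= _).
  apply: pseries_nondecreasing; rewrite ?ler01//; last by rewrite -addn2 leq_addr.
  by move=> m; exact: wcoef_ge0.
rewrite /pseries /series /= big_mkord big_ord_recl /= wcoef0// !mul0r add0r.
have h : 0 <= 2 / Num.sqrt n.+1%:R :> R by rewrite divr_ge0 ?sqrtr_ge0.
have := ler_wpM2l C0 (sum_inv_sqrt3 n); rewrite mulrBr => H.
apply: (@le_trans _ _ (C * \sum_(m < n.+1) (Num.sqrt m.+1%:R ^+ 3)^-1)); last first.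
  by apply: le_trans H _; rewrite gerBl mulr_ge0.
rewrite mulr_sumr; apply: ler_sum => i _.
have si : 0 < Num.sqrt i.+1%:R :> R by rewrite sqrtr_gt0 ltr0n.
rewrite expr1n mulr1 /= ler_pdivlMr ?exprn_gt0// exprS mulrA sqr_sqrtr//.
by rewrite mulrAC divfK ?pnatr_eq0.
Qed.

(** For nonnegative coefficients Abel's theorem follows from monotonicity: the limit at 1 bounds all
    values from above, and one fixed partial sum, continuous in its argument, bounds them from
    below. *)
Lemma abel_ge0 (U : Type) (F : set_system U) (FF : ProperFilter F) (f : U -> R) (c : nat -> R) :
  (forall n, 0 <= c n) -> cvgn (pseries c 1) ->
  f @ F --> (1 : R) -> (\forall y \near F, 0 <= f y <= 1) ->
  limn (pseries c (f y)) @[y --> F] --> limn (pseries c 1).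
Proof.
move=> c0 c1 f1 f01.
have le1 x n : 0 <= x <= 1 -> pseries c x n <= pseries c 1 n.
  move=> /andP[x0 x1]; rewrite /pseries /series /=; apply: ler_sum => i _.
  rewrite expr1n ler_wpM2l//.
  exact: exprn_ile1.
have cx x : 0 <= x <= 1 -> cvgn (pseries c x).
  move=> x01; apply: nondecreasing_is_cvgn.
    by apply: pseries_nondecreasing; case/andP: x01.
  exists (limn (pseries c 1)) => _ [n _ <-]; rewrite (le_trans (le1 _ _ x01))//.
  apply: nondecreasing_cvgn_le => //.
  by apply: pseries_nondecreasing => //; exact: ler01.
apply/cvgrPdist_le => /= e e0.
have e2 : 0 < e / 2 by lra.
have /cvgrPdist_le/(_ _ e2)[N _ HN] := c1.
have pc : pseries c (f y) N @[y --> F] --> pseries c 1 N.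
  rewrite /pseries /series /=; elim: N {HN} => [|N IH].
    under eq_fun do rewrite big_geq//; rewrite big_geq//; exact: cvg_cst.
  under eq_fun do rewrite big_nat_recr//=; rewrite big_nat_recr//=.
  apply: cvgD => //; apply: cvgMl_tmp.
  apply: (@cvg_comp _ _ _ f (fun x : R => x ^+ N) _ _ _ f1); exact: exprn_continuous.
have /cvgrPdist_le/(_ _ e2) pcN := pc.
near=> y.
have y01 : 0 <= f y <= 1 by near: y.
have hN := HN N (leqnn N); have hy : `|pseries c 1 N - pseries c (f y) N| <= e / 2 by near: y.
have l1 : limn (pseries c (f y)) <= limn (pseries c 1).
  apply: ler_lim => //; first exact: cx.
  by apply: nearW => n; exact: le1.
have l2 : pseries c (f y) N <= limn (pseries c (f y)).
  apply: nondecreasing_cvgn_le; last exact: cx.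
  by apply: pseries_nondecreasing => //; case/andP: y01.
rewrite ger0_norm ?subr_ge0//.
move: hN hy; rewrite !ler_norml => /andP[_ ?] /andP[_ ?]; lra.
Unshelve. all: by end_near.
Qed.

End Abel.

(** * Integration and products *)

Section Primitives.
Variable R : realType.
Implicit Types (f g F G : R -> R) (x : R).

(** Plays the role of the integral of [g] from 0. The limit at 0 fixes the constant, so that an
    integration by parts becomes an equality of functions through [prim_uniq]. *)
Definition prim g F :=
  (forall x, 0 < x < 1 -> is_derive x 1 F (g x)) /\ F x @[x --> 0^'+] --> (0 : R).

Lemma prim_eq g h F : (forall x, 0 < x < 1 -> g x = h x) -> prim g F -> prim h F.
Proof. by move=> gh [dF F0]; split => // x x01; rewrite -gh//; exact: dF. Qed.

Lemma prim0 : prim (fun=> 0) (fun=> 0).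
Proof. by split => [x _|]; [exact: is_derive_cst|exact: cvg_cst]. Qed.

Lemma primD g h F G : prim g F -> prim h G -> prim (fun x => g x + h x) (fun x => F x + G x).
Proof.
move=> [dF F0] [dG G0]; split => [x x01|].
  by have := dF x x01; have := dG x x01; move=> *; exact: is_deriveD.
by rewrite -[X in _ --> X]addr0; exact: cvgD.
Qed.

Lemma primZ c g F : prim g F -> prim (fun x => c * g x) (fun x => c * F x).
Proof.
move=> [dF F0]; split => [x x01|].
  by have := dF x x01; move=> *; exact: is_deriveZ.
by rewrite -[X in _ --> X](mulr0 c); exact: cvgMl_tmp.
Qed.

(** By the mean value theorem the difference is constant on (0, x], and its limit at 0 is 0. *)
Lemma prim_uniq g h F G : prim g F -> prim h G ->
  (forall x, 0 < x < 1 -> g x = h x) -> forall x, 0 < x < 1 -> F x = G x.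
Proof.
move=> pF pG gh x x01.
have [dD D0] : prim (fun=> 0) (fun x => F x + (-1) * G x).
  apply: prim_eq (primD pF (primZ (-1) pG)) => y y01 /=.
  by rewrite gh// mulN1r subrr.
pose D y := F y + -1 * G y.
have Dcst y : 0 < y < x -> D y = D x.
  move=> /andP[y0 yx]; case/andP: x01 => x0 x1.
  have d01 z : z \in `[y, x] -> is_derive z 1 D 0.
    rewrite in_itv /= => /andP[yz zx]; apply: dD.
    by rewrite (lt_le_trans y0 yz) (le_lt_trans zx x1).
  have Dc : {within `[y, x], continuous D}.
    by apply: derivable_within_continuous => z zyx; have [] := d01 z zyx.
  have d01' (z : R) : z \in `]y, x[%R -> is_derive z 1 D ((fun=> 0 : R) z).
    by move=> /subset_itv_oo_cc; exact: d01.
  have [c _] := @MVT R D (fun=> 0 : R) y x yx d01' Dc.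
  by rewrite mul0r => /eqP; rewrite subr_eq0 => /eqP.
have : D y @[y --> 0^'+] --> D x.
  apply: cvg_near_cst; near=> y; apply: Dcst; apply/andP; split; near: y.
    exact: nbhs_right_gt.
  by apply: nbhs_right_lt; case/andP: x01.
move=> /(cvg_unique _ D0) D0x; have : D x = 0 by rewrite -D0x.
rewrite /D mulN1r => /eqP.
by rewrite subr_eq0 => /eqP.
Unshelve. all: by end_near.
Qed.

Section Combo.
Variables (I : eqType) (P : I -> R -> Prop) (b : I -> R -> R).

(** Linear combinations on (0, 1). The relation [P] ties each coefficient to its basis function,
    which covers rational coefficients as well as those whose weight depends on the basis
    function. *)
Definition combo f := exists s : seq (I * R),
  (forall p, p \in s -> P p.1 p.2) /\
  forall x, 0 < x < 1 -> f x = \sum_(p <- s) p.2 * b p.1 x.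

Lemma combo_eq f g : (forall x, 0 < x < 1 -> f x = g x) -> combo f -> combo g.
Proof. by move=> fg [s [Ps fE]]; exists s; split => // x x01; rewrite -fg// fE. Qed.

Lemma combo0 : combo (fun=> 0).
Proof. by exists [::]; split => // x _; rewrite big_nil. Qed.

Lemma combo1 i c : P i c -> combo (fun x => c * b i x).
Proof.
move=> Pic; exists [:: (i, c)]; split => [p|x _]; last by rewrite big_seq1.
by rewrite inE => /eqP ->.
Qed.

Lemma comboD f g : combo f -> combo g -> combo (fun x => f x + g x).
Proof.
move=> [s [Ps fE]] [t [Pt gE]]; exists (s ++ t); split => [p|x x01].
  by rewrite mem_cat => /orP[/Ps|/Pt].
by rewrite big_cat fE// gE.
Qed.

Lemma combo_ind (K : (R -> R) -> Prop) f :
  (forall f g, (forall x, 0 < x < 1 -> f x = g x) -> K f -> K g) ->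
  K (fun=> 0) -> (forall f i c, P i c -> K f -> K (fun x => c * b i x + f x)) ->
  combo f -> K f.
Proof.
move=> Keq K0 KD [s [Ps fE]].
apply: (Keq (fun x => \sum_(p <- s) p.2 * b p.1 x)) => [x /fE //|].
elim: s Ps {fE} => [|p s IH] Ps.
  by apply: Keq K0 => x _; rewrite big_nil.
apply: (Keq (fun x => p.2 * b p.1 x + \sum_(p <- s) p.2 * b p.1 x)) => [x _|].
  by rewrite big_cons.
apply: KD; first by apply: Ps; rewrite mem_head.
by apply: IH => q qs; apply: Ps; rewrite inE qs orbT.
Qed.

End Combo.

(** Substitutes an expansion for every basis function, while [h] carries along a fixed factor such
    as a constant or a power of [L]. *)
Lemma combo_bind (I J : eqType) P (b : I -> R -> R) Q (e : J -> R -> R) f h :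
  combo P b f -> (forall i c, P i c -> combo Q e (fun x => h x * (c * b i x))) ->
  combo Q e (fun x => h x * f x).
Proof.
move=> cf H; apply: (combo_ind (K := fun f => combo Q e (fun x => h x * f x)) _ _ _ cf).
- by move=> f1 f2 f12; apply: combo_eq => x x01; rewrite f12.
- by apply: combo_eq (combo0 _ _) => x _; rewrite mulr0.
- move=> f1 i c Pic K1; apply: combo_eq (comboD (H i c Pic) K1) => x _ /=.
  by rewrite mulrDr.
Qed.

Lemma combo_prim (I J : eqType) P (b : I -> R -> R) Q (e : J -> R -> R) f h :
  combo P b f ->
  (forall i c, P i c -> exists2 F, combo Q e F & prim (fun x => h x * (c * b i x)) F) ->
  exists2 F, combo Q e F & prim (fun x => h x * f x) F.
Proof.
move=> cf H.
apply: (combo_ind (K := fun f => exists2 F, combo Q e F & prim (fun x => h x * f x) F) _ _ _ cf).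
- move=> f1 f2 f12 [F cF pF]; exists F => //.
  by apply: prim_eq pF => x x01; rewrite f12.
- exists (fun=> 0); first exact: combo0.
  by apply: prim_eq prim0 => x _; rewrite mulr0.
- move=> f1 i c Pic [F cF pF]; have [G cG pG] := H i c Pic.
  exists (fun x => G x + F x); first exact: comboD.
  by apply: prim_eq (primD pG pF) => x _ /=; rewrite mulrDr.
Qed.

Lemma combo_comp (I : eqType) P (b : I -> R -> R) f (u : R -> R) :
  (forall x, 0 < x < 1 -> 0 < u x < 1) -> combo P b f ->
  combo P (fun i x => b i (u x)) (fun x => f (u x)).
Proof. by move=> u01 [s [Ps fE]]; exists s; split => // x /u01 /fE. Qed.

Lemma cvgX (T : Type) (A : set_system T) (FA : Filter A) (f : T -> R) (l : R) n :
  f @ A --> l -> f x ^+ n @[x --> A] --> l ^+ n.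
Proof.
move=> fl; apply: (@cvg_comp _ _ _ f (fun x : R => x ^+ n) _ _ _ fl); exact: exprn_continuous.
Qed.

End Primitives.

(** * Products with powers of A(1; .) and regularization *)

Section Products.
Variable R : realType.
Implicit Types (x c : R) (w v : seq bool).
Notation li := (@li R).
Notation L := (li [:: true]).
Local Notation dform := (@dform R).

Lemma li_is_derive_cons b w x : good (b :: w) -> 0 < x < 1 ->
  is_derive x 1 (li (b :: w)) (dform b x * li w x).
Proof.
move=> gw /andP[x0 x1]; have x1' : `|x| < 1 by rewrite ger0_norm ?ltW.
case: b gw => gw; first exact: li_is_derive_true.
by apply: li_is_derive_false; rewrite ?gt_eqF//; case: w gw.
Qed.

Lemma li_cvg0 w : w != [::] -> li w x @[x --> 0^'+] --> (0 : R).
Proof.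
move=> w0; rewrite -[X in _ --> X](li0 R w0); apply: cvg_at_right_filter.
have := @li_continuous R w 0; rewrite normr0 => h; exact: h.
Qed.

Lemma prim_li b w : good (b :: w) -> prim (fun x => dform b x * li w x) (li (b :: w)).
Proof. by move=> gw; split => [x|]; [exact: li_is_derive_cons|exact: li_cvg0]. Qed.

Definition is_ratr c := exists q : rat, c = ratr q.

Lemma is_ratr1 : is_ratr 1. Proof. by exists 1; rewrite rmorph1. Qed.
Lemma is_ratrM c d : is_ratr c -> is_ratr d -> is_ratr (c * d).
Proof. by move=> [p ->] [q ->]; exists (p * q); rewrite rmorphM. Qed.
Lemma is_ratrN c : is_ratr c -> is_ratr (- c).
Proof. by move=> [p ->]; exists (- p); rewrite rmorphN. Qed.
Lemma is_ratr_nat n : is_ratr n%:R.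
Proof. by exists n%:R; rewrite ratr_nat. Qed.
Lemma is_ratrV c : is_ratr c -> is_ratr c^-1.
Proof. by move=> [p ->]; exists p^-1; rewrite fmorphV. Qed.

Definition qwords (p : pred (seq bool)) w c := [/\ good w, p w & is_ratr c].

Lemma combo_prim_li b p q f : combo (qwords p) li f ->
  (forall v, p v -> good v -> good (b :: v) && q (b :: v)) ->
  exists2 F, combo (qwords q) li F & prim (fun x => dform b x * f x) F.
Proof.
move=> cf pq; apply: combo_prim cf _ => v c [gv pv rc].
have /andP[gbv qbv] := pq v pv gv.
exists (fun x => c * li (b :: v) x); first exact: combo1.
by apply: prim_eq (primZ c (prim_li gbv)) => x _; rewrite mulrCA.
Qed.

(** Nonemptiness is recorded because prepending [false] keeps a word good only if it is nonempty. *)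
Definition of_size n : pred (seq bool) := fun w => (w != [::]) && (size w == n).
Arguments of_size n%_N w.

(** The shuffle product of one letter with a word. The derivative of L * li (b w) has two terms:
    [dform b] times L * li w, known by induction, and [dform true] times li (b w), which integrates
    to a single word. *)
Lemma combo_L_mul w : good w -> combo (qwords (of_size (size w).+1)) li (fun x => L x * li w x).
Proof.
elim: w => [|b w IH] gw.
  apply: combo_eq (combo1 (i := [:: true]) (c := 1) _ _) => [x _|].
    by rewrite li_nil mul1r mulr1.
  by split => //; exact: is_ratr1.
have [G cG pG] : exists2 F, combo (qwords (of_size (size w).+2)) li F &
    prim (fun x => dform b x * (L x * li w x)) F.
  apply: combo_prim_li (IH (goodW gw)) _ => v /andP[v0 /eqP sv] gv.
  by rewrite good_cons// gv /of_size -sv /= eqxx.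
apply: combo_eq (comboD cG (combo1 (i := true :: b :: w) (c := 1) _ _)); last first.
  by split => //; [rewrite /of_size eqxx|exact: is_ratr1].
move=> x x01 /=; rewrite mul1r; apply/esym.
have pT := @prim_li true (b :: w) gw.
have pF : prim (fun x => dform b x * (L x * li w x) + dform true x * li (b :: w) x)
    (fun x => L x * li (b :: w) x).
  split => [y y01|].
    have dL := @li_is_derive_cons true [::] y isT y01; rewrite li_nil mulr1 in dL.
    have dw := li_is_derive_cons gw y01.
    apply: is_derive_eq; rewrite /GRing.scale/=; ring.
  rewrite -[X in _ --> X](mulr0 0); apply: cvgM; exact: li_cvg0.
exact: (prim_uniq pF (primD pG pT)).
Qed.

Lemma combo_LX_mul j v : good v -> v != [::] ->
  combo (qwords (of_size (j + size v))) li (fun x => L x ^+ j * li v x).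
Proof.
move=> gv v0; elim: j => [|j IH].
  apply: combo_eq (combo1 (i := v) (c := 1) _ _) => [x _|]; first by rewrite expr0.
  by split; [|rewrite /of_size v0 /=|exact: is_ratr1].
suff : combo (qwords (of_size (j.+1 + size v))) li (fun x => L x * (L x ^+ j * li v x)).
  by apply: combo_eq => x _; rewrite exprS mulrA.
apply: combo_bind IH _ => w c [gw /andP[w0 /eqP sw] rc].
have : combo (qwords (of_size (j.+1 + size v))) li (fun x => c * (L x * li w x)).
  apply: (@combo_bind _ _ _ _ _ _ _ _ (fun=> c)); first exact: (combo_L_mul gw).
  move=> w' c' [gw' pw' rc']; apply: combo_eq (combo1 (i := w') (c := c * c') _ _) => [x _|].
    by rewrite mulrA.
  by split => //; [move: pw'; rewrite sw|exact: is_ratrM].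
by apply: combo_eq => x _; rewrite mulrCA.
Qed.

(** The word is empty or begins with [false], that is, its index is empty or admissible. *)
Definition qpowers n (i : nat * seq bool) c :=
  [/\ good i.2, ~~ head false i.2, (i.1 + size i.2 = n)%N & is_ratr c].

Definition lpower (i : nat * seq bool) x := L x ^+ i.1 * li i.2 x.

Lemma L_pow_is_derive j x : 0 < x < 1 ->
  is_derive x 1 (fun y => L y ^+ j.+1) (j.+1%:R * dform true x * L x ^+ j).
Proof.
move=> x01; have dL := @li_is_derive_cons true [::] x isT x01; rewrite li_nil mulr1 in dL.
elim: j => [|j IH].
  rewrite (_ : (fun y => _) = L); last by apply/funext => y; rewrite expr1.
  by apply: is_derive_eq; rewrite expr0 mulr1 mul1r.
rewrite (_ : (fun y => _) = L * (fun y => L y ^+ j.+1)); last first.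
  by apply/funext => y; rewrite exprS.
apply: is_derive_eq; rewrite /GRing.scale/= !exprS -[in RHS]natr1; ring.
Qed.

Lemma L_pow_cvg0 j : L x ^+ j.+1 @[x --> 0^'+] --> (0 : R).
Proof.
have := @cvgX R _ _ _ _ _ j.+1 (@li_cvg0 [:: true] isT).
by rewrite [0 ^+ _]exprS mul0r; apply.
Qed.

Lemma lpower_cvg0 j v : lpower (j.+1, v) x @[x --> 0^'+] --> (0 : R).
Proof.
rewrite -[X in _ --> X](mul0r (li v 0)); apply: cvgM; first exact: L_pow_cvg0.
by apply: cvg_at_right_filter; have := @li_continuous R v 0; rewrite normr0 => h; exact: h.
Qed.

(* Shuffle regularization, carried out by integrating by parts: the leading
   letters [true] are pulled out of the word as powers of [L]. *)
Lemma combo_lpower w : good w -> combo (qpowers (size w)) lpower (li w).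
Proof.
elim: w => [|[] w IH] gw.
- apply: combo_eq (combo1 (i := (0, [::])) (c := 1) _ _) => [x _|].
    by rewrite /lpower/= li_nil expr0 !mulr1.
  by split => //; exact: is_ratr1.
- have [F cF pF] : exists2 F, combo (qpowers (size w).+1) lpower F &
      prim (fun x => dform true x * li w x) F.
    apply: combo_prim (IH (goodW gw)) _ => -[j v] c [/= gv hv sv rc].
    have rj : is_ratr (c / j.+1%:R) by apply: is_ratrM => //; apply: is_ratrV; exact: is_ratr_nat.
    (* For empty [v] the integral of L^j dL is L^(j+1)/(j+1). *)
    case: v gv hv sv => [|[]//v] gv _ sv.
      exists (fun x => c / j.+1%:R * lpower (j.+1, [::]) x).
        by apply: combo1; split => //=; rewrite addSn sv.
      split => [x x01|].
        have dL := L_pow_is_derive j x01; rewrite /lpower /=.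
        under eq_fun do rewrite li_nil mulr1.
        apply: is_derive_eq; rewrite li_nil /GRing.scale/=; field.
        by rewrite nat1r pnatr_eq0.
      by rewrite -[X in _ --> X](mulr0 (c / j.+1%:R)); apply: cvgMl_tmp; exact: lpower_cvg0.
    (* Otherwise integrate L^j dL by parts. In the remaining integral L^(j+1) li v expands into
       words, and the outer form prepends [false], so nothing is left to pull out. *)
    have v0 : v != [::] by case: v gv {sv}.
    have [G cG pG] : exists2 G, combo (qwords (fun w =>
          of_size (j.+1 + size (false :: v)) w && ~~ head false w)) li G &
        prim (fun x => dform false x * (L x ^+ j.+1 * li v x)) G.
      apply: combo_prim_li (combo_LX_mul j.+1 (goodW gv) v0) _ => w' /andP[w'0 /eqP sw'] gw'.
      by rewrite good_cons// gw' /of_size /= sw' addnS eqxx.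
    exists (fun x => c / j.+1%:R * lpower (j.+1, false :: v) x + - (c / j.+1%:R) * G x).
      apply: comboD; first by apply: combo1; split => //=; rewrite addSn sv.
      apply: (@combo_bind _ _ _ _ _ _ _ _ (fun=> - (c / j.+1%:R))); first exact: cG.
      move=> w' c' [gw' /andP[/andP[w'0 /eqP sw'] hw'] rc'].
      apply: combo_eq (combo1 (i := (0, w')) (c := - (c / j.+1%:R) * c') _ _) => [x _|].
        by rewrite /lpower/= expr0 mul1r mulrA.
      by split => //=; [rewrite sw' addSn sv|apply: is_ratrM => //; exact: is_ratrN].
    apply: prim_eq (primD _ (primZ _ pG)); last first.
      split => [x x01|]; last first.
        by rewrite -[X in _ --> X](mulr0 (c / j.+1%:R)); apply: cvgMl_tmp; exact: lpower_cvg0.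
      have dL := L_pow_is_derive j x01; have dv := li_is_derive_cons gv x01.
      rewrite /lpower /=; apply: is_derive_eq; reflexivity.
    move=> x _ /=; rewrite /lpower /GRing.scale /=; field.
    by rewrite nat1r pnatr_eq0.
  by apply: combo_eq cF => x x01; apply: (prim_uniq pF (prim_li gw)).
- apply: combo_eq (combo1 (i := (0, false :: w)) (c := 1) _ _) => [x _|].
    by rewrite /lpower/= expr0 !mul1r.
  by split => //; exact: is_ratr1.
Qed.

Lemma li_nseq_true j x : 0 < x < 1 -> li (nseq j true) x = L x ^+ j / j`!%:R.
Proof.
elim: j x => [|j IH] x x01; first by rewrite /= li_nil expr0 divr1.
have gj n : good (nseq n true) by elim: n => // n; case: n.
have pG : prim (fun y => dform true y * (L y ^+ j / j`!%:R))
    (fun y => (j.+1`!%:R)^-1 * L y ^+ j.+1).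
  split => [y y01|]; last first.
    by rewrite -[X in _ --> X](mulr0 (j.+1`!%:R^-1)); apply: cvgMl_tmp; exact: L_pow_cvg0.
  have dL := L_pow_is_derive j y01.
  apply: is_derive_eq; rewrite factS natrM /GRing.scale /=; field.
  by rewrite nat1r !pnatr_eq0 -lt0n fact_gt0.
rewrite mulrC; apply: (prim_uniq (prim_li (gj j.+1)) pG) => // y y01.
by rewrite -IH.
Qed.

End Products.

(** * Duality *)

Section Duality.
Variable R : realType.
Implicit Types (x z c : R) (w v : seq bool).
Notation li := (@li R).
Notation L := (li [:: true]).
Local Notation dform := (@dform R).

Definition u z : R := (1 - z) / (1 + z).

Lemma u_in z : 0 < z < 1 -> 0 < u z < 1.
Proof.
move=> /andP[z0 z1]; have z1' : 0 < 1 + z by lra.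
by rewrite /u divr_gt0 ?subr_gt0//= ltr_pdivrMr// mul1r; lra.
Qed.

Lemma u_is_derive z : 0 < z < 1 -> is_derive z 1 u (- 2 / (1 + z) ^+ 2).
Proof.
move=> /andP[z0 z1]; have z1' : 1 + z != 0 by rewrite gt_eqF//; lra.
have dV : is_derive z 1 (fun y : R => (1 + y)^-1) (- (1 + z) ^- 2 *: 1).
  have d1 : is_derive z 1 (fun y : R => 1 + y) 1 by apply: is_derive_eq; ring.
  exact: (is_deriveV (f := fun y => 1 + y)).
apply: is_derive_eq; rewrite /GRing.scale /=; field.
by [].
Qed.

Lemma li_u_is_derive b w z : good (b :: w) -> 0 < z < 1 ->
  is_derive z 1 (fun y => li (b :: w) (u y)) (- dform (~~ b) z * li w (u z)).
Proof.
move=> gw z01; have du := u_is_derive z01.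
have dl := li_is_derive_cons gw (u_in z01).
apply: (is_derive_eq (is_derive1_comp dl du)).
rewrite mulrAC; congr (_ * _); case/andP: z01 => z0 z1.
case: {gw dl} b; rewrite /dform /u /=; field; do ?[apply/andP; split]; rewrite gt_eqF//; nra.
Qed.

(** Thus L(x) = log((1+x)/(1-x)) and L(u z) = -log z, which controls the growth of L(u z) at 0. It
    holds because exp(L) u - 1 has zero derivative and limit 0. *)
Lemma expR_L x : 0 < x < 1 -> expR (L x) = (1 + x) / (1 - x).
Proof.
have pF : prim (fun=> 0 : R) (fun x => expR (L x) * u x - 1).
  split => [y y01|].
    have dL := @li_is_derive_cons R true [::] y isT y01; rewrite li_nil mulr1 in dL.
    have du := u_is_derive y01; have dE := is_derive1_comp (is_derive_expR (L y)) dL.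
    apply: is_derive_eq; rewrite /GRing.scale /= /dform /u; case/andP: y01 => y0 y1; field.
    by do ?[apply/andP; split]; rewrite gt_eqF//; nra.
  rewrite [X in _ --> X](_ : 0 = expR (L 0) * u 0 - 1 :> R); last first.
    by rewrite li0// expR0 /u subr0 addr0 divr1 mulr1 subrr.
  apply: cvg_at_right_filter; apply: cvgB; last exact: cvg_cst.
  apply: cvgM.
    apply: (@cvg_comp _ _ _ L expR _ (nbhs (L 0))); last exact: continuous_expR.
    by have := @li_continuous R [:: true] 0; rewrite normr0 => h; exact: h.
  apply: cvgM; first by apply: cvgB; [exact: cvg_cst|exact: cvg_id].
  apply: cvgV; first by rewrite addr0 oner_eq0.
  by apply: cvgD; [exact: cvg_cst|exact: cvg_id].
move=> x01; have /eqP := prim_uniq pF (prim0 R) (fun _ _ => erefl) x01.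
rewrite subr_eq0 => /eqP; case/andP: x01 => x0 x1.
have ux : u x != 0 by rewrite gt_eqF//; have := @u_in x; rewrite x0 x1 => /(_ isT)/andP[].
move=> /(canRL (mulfK ux)) ->; rewrite /u; field.
by do ?[apply/andP; split]; rewrite gt_eqF//; lra.
Qed.

Lemma expR_L_u z : 0 < z < 1 -> expR (L (u z)) = z^-1.
Proof.
move=> z01; rewrite expR_L ?u_in//; case/andP: z01 => z0 z1; rewrite /u; field.
by do ?[apply/andP; split]; rewrite gt_eqF//; lra.
Qed.

Lemma L_u_ge0 z : 0 < z < 1 -> 0 <= L (u z).
Proof.
move=> z01; rewrite -ler_expR expR0 expR_L_u//; case/andP: z01 => z0 z1.
by rewrite -[leLHS]invr1 lef_pV2 ?posrE// ltW.
Qed.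

Lemma mul_L_u_cvg0 j : z * L (u z) ^+ j @[z --> 0^'+] --> (0 : R).
Proof.
(* With t = L(u z), z = exp(-t). A single term of the exponential series gives t^j <= C exp(t/2),
   hence z t^j <= C sqrt z. *)
pose C : R := 2 ^+ j * j`!%:R.
have bound z : 0 < z < 1 -> 0 <= z * L (u z) ^+ j <= C * Num.sqrt z.
  move=> z01; have := L_u_ge0 z01; have := expR_L_u z01; case/andP: z01 => z0 z1.
  move: (L (u z)) => t tz t0; rewrite mulr_ge0 ?exprn_ge0 ?(ltW z0)//=.
  have sE : Num.sqrt z * expR (t / 2) = 1.
    rewrite -[z in LHS]invrK -tz -expRN (_ : - t = - (t / 2) + - (t / 2)) ?expRD; last lra.
    by rewrite -expr2 sqrtr_sqr ger0_norm ?expR_ge0// -expRD addNr expR0.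
  have tj : t ^+ j <= C * expR (t / 2).
    have t2 : 0 <= t / 2 by rewrite divr_ge0.
    have : (t / 2) ^+ j / j`!%:R <= expR (t / 2).
      case: (j) => [|n]; first by rewrite expr0 fact0 divr1 (le_trans _ (expR_ge1Dx _))// lerDl.
      by apply: le_trans (expR_ge1Dxn n t2); rewrite lerDr.
    rewrite ler_pdivrMr ?ltr0n ?fact_gt0// expr_div_n ler_pdivrMr ?exprn_gt0//.
    by rewrite /C => h; apply: le_trans h _; rewrite le_eqVlt; apply/orP; left; apply/eqP; ring.
  have -> : z * t ^+ j = Num.sqrt z * (Num.sqrt z * t ^+ j).
    by rewrite mulrA -expr2 sqr_sqrtr// ltW.
  rewrite mulrC ler_wpM2r ?sqrtr_ge0//.
  have := ler_wpM2l (sqrtr_ge0 z) tj; rewrite mulrCA sE mulr1; exact.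
have sq0 : C * Num.sqrt z @[z --> 0^'+] --> (0 : R).
  rewrite -[X in _ --> X](mulr0 C); apply: cvgMl_tmp; rewrite -[X in _ --> X](@sqrtr0 R).
  by apply: cvg_at_right_filter; exact: sqrt_continuous.
apply: (@squeeze_cvgr _ _ _ _ (fun=> 0) (fun z => C * Num.sqrt z)) => //; last exact: cvg_cst.
near=> z; apply: bound; apply/andP; split; near: z.
  exact: nbhs_right_gt.
exact: nbhs_right_lt.
Unshelve. all: by end_near.
Qed.

(** The boundary term in the integrations by parts: [li v] vanishes at 0 and is differentiable
    there, so li v z / z has a finite limit, while z L(u z)^j tends to 0. *)
Lemma li_L_u_cvg0 v j : v != [::] -> L (u z) ^+ j * li v z @[z --> 0^'+] --> (0 : R).
Proof.
move=> v0.
have [d Hd] : exists d : R, z^-1 * li v z @[z --> 0^'+] --> d.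
  have [dv _] : is_derive (0 : R) (1 : R) (li v) (limn (pseries (pseries_diffs (wcoef R v)) 0)).
    by apply: li_is_derive; rewrite normr0.
  move: dv => /cvg_ex [d Hd]; exists d.
  have {}Hd : (fun h => h^-1 *: ((li v \o shift 0) (h *: (1 : R)) - li v 0)) @ 0^'+ --> d.
    apply: cvg_trans Hd; apply: cvg_app => P [e e0 He].
    by exists e => // y ye y0; apply: He => //; rewrite gt_eqF.
  apply: cvg_trans Hd; apply: near_eq_cvg; near=> h.
  by rewrite /= addr0 (li0 R v0) subr0 /GRing.scale /= mulr1.
rewrite -[X in _ --> X](mul0r d).
have E : {near (0 : R)^'+, (fun z => z * L (u z) ^+ j * (z^-1 * li v z)) =1
    (fun z => L (u z) ^+ j * li v z)}.
  near=> z; have z0 : z != 0 by rewrite gt_eqF//; near: z; exact: nbhs_right_gt.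
  by rewrite /= [z * _]mulrC -mulrA mulVKf.
exact: cvg_trans (near_eq_cvg E) (cvgM (mul_L_u_cvg0 j) Hd).
Unshelve. all: by end_near.
Qed.

Definition lupower (i : nat * seq bool) z := L (u z) ^+ i.1 * li i.2 z.

Definition nupowers n (i : nat * seq bool) c :=
  [/\ good i.2, i.2 != [::], (i.1 + size i.2 = n)%N & is_ratr c].
Arguments nupowers n%_N i c.

Lemma L_u_pow_is_derive j z : 0 < z < 1 ->
  is_derive z 1 (fun y => L (u y) ^+ j.+1) (- j.+1%:R * dform false z * L (u z) ^+ j).
Proof.
move=> z01; have dL := @li_u_is_derive true [::] z isT z01.
rewrite li_nil mulr1 in dL.
elim: j => [|j IH].
  rewrite (_ : (fun y => _) = (fun y => L (u y))); last by apply/funext => y; rewrite expr1.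
  by apply: is_derive_eq; rewrite expr0 mulr1 mulN1r.
rewrite (_ : (fun y => _) = (fun y => L (u y)) * (fun y => L (u y) ^+ j.+1)); last first.
  by apply/funext => y; rewrite exprS.
apply: is_derive_eq; rewrite /GRing.scale/= !exprS -[in RHS]natr1; ring.
Qed.

(* Repeated integration by parts: each step trades a factor [L (u z)] for a letter [false]. *)
Lemma prim_lupower b v j : good (b :: v) ->
  exists2 F, combo (nupowers (j + size v).+1) lupower F &
    prim (fun z => dform b z * (L (u z) ^+ j * li v z)) F.
Proof.
elim: j b v => [|j IH] b v gv.
  exists (li (b :: v)).
    apply: combo_eq (combo1 (i := (0, b :: v)) (c := 1) _ _) => [z _|].
      by rewrite /lupower /= expr0 !mul1r.
    by split => //; exact: (is_ratr1 R).
  by apply: prim_eq (prim_li R gv) => z _; rewrite expr0 mul1r.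
have [|G cG pG] := IH false (b :: v); first by rewrite good_cons.
(* The sign is plus because L(u z) has derivative -1/z. *)
exists (fun z => lupower (j.+1, b :: v) z + j.+1%:R * G z).
  apply: comboD.
    apply: combo_eq (combo1 (i := (j.+1, b :: v)) (c := 1) _ _) => [z _|]; first by rewrite mul1r.
    by split => //=; [rewrite addnS|exact: (is_ratr1 R)].
  apply: combo_bind cG _ => -[i w] c [/= gw w0 sw rc].
  apply: combo_eq (combo1 (i := (i, w)) (c := j.+1%:R * c) _ _) => [z _|]; first by rewrite mulrA.
  by split => //=; [rewrite sw /= addnS|apply: is_ratrM => //; exact: (is_ratr_nat R)].
have pF : prim (fun z => - j.+1%:R * dform false z * L (u z) ^+ j * li (b :: v) z +
    L (u z) ^+ j.+1 * (dform b z * li v z)) (lupower (j.+1, b :: v)).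
  split => [z z01|]; last exact: li_L_u_cvg0.
  have dL := L_u_pow_is_derive j z01; have dv := li_is_derive_cons gv z01.
  rewrite /lupower /=; apply: is_derive_eq; rewrite /GRing.scale /=; ring.
by apply: prim_eq (primD pF (primZ j.+1%:R pG)) => z _ /=; ring.
Qed.

Definition tpowers n (i : nat * seq bool) c :=
  [/\ good i.2, (i.1 + size i.2 <= n)%N & T_combination (n - size i.2 - i.1)%N c].

Lemma T_combinationZ n (q c : R) : is_ratr q -> T_combination n c -> T_combination n (q * c).
Proof.
move=> [r ->] [s [Ts ->]]; exists [seq (r * p.1, p.2) | p <- s]; split.
  by move=> _ /mapP[p ps ->]; exact: (Ts p ps).
by rewrite mulr_sumr big_map; apply: eq_bigr => p _ /=; rewrite rmorphM mulrA.
Qed.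

Lemma T_combinationD n (c d : R) :
  T_combination n c -> T_combination n d -> T_combination n (c + d).
Proof.
move=> [s [Ts ->]] [t [Tt ->]]; exists (s ++ t); split; last by rewrite big_cat.
by move=> p; rewrite mem_cat => /orP[/Ts|/Tt].
Qed.

Lemma T_combination0 n : T_combination n (0 : R).
Proof. by exists [::]; split => //; rewrite big_nil. Qed.

Lemma T_value_combination n (x : R) : is_T_value n x -> T_combination n x.
Proof.
move=> Tx; exists [:: (1, x)]; split; last by rewrite big_seq1 rmorph1 mul1r.
by move=> p; rewrite inE => /eqP ->.
Qed.

Lemma li1_T_value w : good (false :: w) -> is_T_value (size w).+1 (li (false :: w) 1).
Proof.
move=> gw; right; exists (rev (idx (false :: w))); split; last by rewrite /T A_idx.
- case E : (idx w) => [|c s]; first by move: (gw); rewrite (idx_nil (goodW gw) E).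
  have := is_index_idx w; rewrite E => /andP[c0 ps].
  rewrite /admissible /is_index all_rev /= E rev_cons last_rcons -size_eq0 size_rcons.
  by apply/and3P; split.
- by rewrite /weight sumn_rev; exact: weight_idx.
Qed.

(** The claim in terms of words, with L^j in place of A({1}_j; .) = L^j / j!; the factorials enter
    only in the final translation. *)
Definition duality w := combo (tpowers (size w)) lupower (fun z => li w (u z)).

Lemma duality_nil : duality [::].
Proof.
apply: combo_eq (combo1 (i := (0, [::])) (c := 1) _ _) => [z _|].
  by rewrite /lupower /= !li_nil expr0 !mul1r.
by split => //; apply: T_value_combination; left.
Qed.

Lemma li_u_cvg w : good (false :: w) ->
  li (false :: w) (u z) @[z --> 0^'+] --> li (false :: w) 1.
Proof.
move=> gw; apply: abel_ge0.
- by move=> n; exact: wcoef_ge0.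
- by apply: wcoef_cvg1; case: w gw.
- have -> : 1 = u 0 by rewrite /u subr0 addr0 divr1.
  apply: cvg_at_right_filter.
  apply: cvgM; first by apply: cvgB; [exact: cvg_cst|exact: cvg_id].
  apply: cvgV; first by rewrite addr0 oner_eq0.
  by apply: cvgD; [exact: cvg_cst|exact: cvg_id].
near=> z; have /andP[u0 u1] : 0 < u z < 1; last by rewrite !ltW.
apply: u_in; apply/andP; split; near: z.
  exact: nbhs_right_gt.
exact: nbhs_right_lt.
Unshelve. all: by end_near.
Qed.

Lemma duality_false w : good (false :: w) -> duality w -> duality (false :: w).
Proof.
move=> gw Dw.
have [F cF pF] : exists2 F, combo (tpowers (size w).+1) lupower F &
    prim (fun z => dform true z * li w (u z)) F.
  apply: combo_prim Dw _ => -[j v] c [/= gv sv Tc].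
  have [|F cF pF] := @prim_lupower true v j; first by case: v gv {sv Tc}.
  exists (fun z => c * F z).
    apply: combo_bind cF _ => -[i v'] d [/= gv' v'0 sv' rd].
    apply: combo_eq (combo1 (i := (i, v')) (c := d * c) _ _) => [z _|].
      by rewrite mulrA [d * c]mulrC.
    split => //=; first by rewrite sv' ltnS.
    (* Integration raises both the weight of the term and the total weight by 1, so the weight left
       to the coefficient is unchanged. *)
    rewrite -subnDA [(size v' + i)%N]addnC sv' subSS addnC subnDA.
    exact: T_combinationZ.
  by apply: prim_eq (primZ c pF) => z _; rewrite mulrCA.
(* Subtracting the limit at 0, a multiple T-value, makes this a primitive that can be compared with
   -F. *)
have pT : prim (fun z => - dform true z * li w (u z))
    (fun z => li (false :: w) (u z) - li (false :: w) 1).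
  split => [z z01|].
    have dl := li_u_is_derive gw z01.
    by apply: is_derive_eq; rewrite subr0.
  rewrite -[X in _ --> X](subrr (li (false :: w) 1)).
  by apply: cvgB; [exact: li_u_cvg|exact: cvg_cst].
have E z : 0 < z < 1 -> li (false :: w) (u z) - li (false :: w) 1 = -1 * F z.
  by apply: (prim_uniq pT (primZ (-1) pF)) => y _; rewrite mulN1r mulNr.
apply: combo_eq (comboD (combo1 (i := (0, [::])) (c := li (false :: w) 1) _ _)
  (combo_bind (h := fun=> -1) cF _)) => [z z01||[j v] c [/= gv sv Tc]].
- by rewrite -E// /lupower /= li_nil expr0 !mulr1 addrC subrK.
- by split => //=; rewrite subn0; apply: T_value_combination; exact: li1_T_value.
- apply: combo_eq (combo1 (i := (j, v)) (c := -1 * c) _ _) => [z _|]; first by rewrite mulrA.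
  by split => //=; apply: T_combinationZ => //; apply: is_ratrN; exact: (is_ratr1 R).
Qed.

(** Strong induction on the length: regularizing [w] may yield words as long as [w], but these are
    empty or begin with [false], and [duality_false] appeals only to their shorter tails. *)
Lemma duality_word w : good w -> duality w.
Proof.
have [n] := ubnP (size w); elim: n w => // n IH w; rewrite ltnS => wn gw.
have adm v : good v -> ~~ head false v -> (size v <= size w)%N -> duality v.
  case: v => [*|[]//v gv _ vw]; first exact: duality_nil.
  by apply: duality_false => //; apply: IH (goodW gv); exact: leq_trans vw wn.
suff : combo (tpowers (size w)) lupower (fun z => 1 * li w (u z)).
  by apply: combo_eq => z _; rewrite mul1r.
apply: (combo_bind (h := fun=> 1) (combo_comp u_in (combo_lpower R gw))) =>
  -[j v] c [/= gv hv sv rc].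
have Dv : duality v by apply: adm; rewrite // -sv leq_addl.
(* The power of L(u z) from the regularization merges with the one in the expansion of li v (u
   z). *)
apply: combo_eq (combo_bind (h := fun z => c * L (u z) ^+ j) Dv _) =>
  [z _|[i v'] d [/= gv' sv' Td]].
  by rewrite /lpower /= mul1r mulrA.
apply: combo_eq (combo1 (i := ((j + i)%N, v')) (c := c * d) _ _) => [z _|].
  by rewrite /lupower /= exprD; ring.
split => //=; first by rewrite -sv -addnA leq_add2l.
rewrite -sv -subnDA addnCA subnDl subnDA; exact: T_combinationZ.
Qed.

End Duality.

(** * From words back to indices *)

Lemma weight_rev s : weight (rev s) = weight s.
Proof. exact: sumn_rev. Qed.

Lemma A_nseq1 (R : realType) j (x : R) : 0 < x < 1 ->
  A (nseq j 1%N) x = li [:: true] x ^+ j / j`!%:R.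
Proof.
move=> x01; rewrite -li_nseq_true//.
have gj : good (nseq j true) by elim: j => // -[].
rewrite -A_idx// (_ : idx _ = nseq j 1%N) ?rev_nseq//.
by elim: j {gj} => //= j ->.
Qed.

Theorem theorem2p4 (R : realType) (k : seq nat)
    (k_neq0 : k != [::]) (k_index : is_index k) :
  exists C : seq nat -> nat -> R,
    (forall (k' : seq nat) (j : nat),
        is_index k' -> (weight k' + j <= weight k)%N ->
        T_combination (weight k - weight k' - j)%N (C k' j)) /\
    (forall z : R, 0 < z -> z < 1 ->
        A k ((1 - z) / (1 + z)) =
        \sum_(p \in index_pairs (weight k))
          C p.1 p.2 * A (nseq p.2 1%N) ((1 - z) / (1 + z)) * A p.1 z).
Proof.
pose w := word (rev k); have gw : good w := good_word _.
have idx_w : rev (idx w) = k by rewrite idx_word ?revK// /is_index all_rev.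
have size_w : weight k = size w by rewrite -idx_w weight_rev; exact: weight_idx.
have [s [Ps sE]] := duality_word R gw.
(* The pair (k', j) to which a term of the expansion contributes; terms with the same key are added
   up, with j! converting L^j into A({1}_j; .). *)
pose key (p : (nat * seq bool) * R) := (rev (idx p.1.2), p.1.1).
exists (fun k' j => \sum_(p <- s | key p == (k', j)) j`!%:R * p.2); split.
  move=> k' j _ _; rewrite big_seq_cond size_w.
  apply: (big_ind (T_combination _)) => [|x y|p /andP[ps /eqP[<- <-]]].
  - exact: T_combination0.
  - exact: T_combinationD.
  - have [gp _ Tp] := Ps p ps; apply: T_combinationZ; first exact: is_ratr_nat.
    by rewrite weight_rev (weight_idx gp).
move=> z z0 z1; have z01 : 0 < z < 1 by rewrite z0 z1.
rewrite -/(u z) -[in LHS]idx_w A_idx// sE//.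
rewrite fsbig_finite; last exact: finite_index_pairs.
under [RHS]eq_bigr do rewrite -mulrA big_distrl /=.
(* After the exchange, each term of the expansion meets exactly one pair of [index_pairs], its own
   key. *)
rewrite (exchange_big_dep xpredT)//=; apply: eq_big_seq => p ps.
have [gp sp _] := Ps p ps.
rewrite -big_filter (eq_filter (a2 := pred1 (key p))); last first.
  by move=> q /=; rewrite -surjective_pairing eq_sym.
rewrite filter_pred1_uniq ?finmap.fset_uniq//; last first.
  rewrite in_fset_set; last exact: finite_index_pairs.
  rewrite inE /index_pairs /=; split; first by rewrite /is_index all_rev; exact: is_index_idx.
  by rewrite weight_rev (weight_idx gp) size_w addnC.
rewrite big_seq1 /= A_nseq1 ?u_in// A_idx// /lupower.
by field; rewrite pnatr_eq0 -lt0n fact_gt0.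
Qed.
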